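(* The isomorphism relation $\cong$ on $\mathrm{Mod}(\mathrm{REF(bin)})$ is not a Borel subset of $\mathrm{Mod}(\mathrm{REF(bin)})\times\mathrm{Mod}(\mathrm{REF(bin)})$.
   Context: $\mathrm{REF(bin)}$ is the first-order theory in the language $\{E_n:n\in\omega\}$ asserting: each $E_n$ is an equivalence relation, $E_0$ has a single class, each $E_{n+1}$ refines $E_n$, and each $E_n$-class is partitioned into exactly two $E_{n+1}$-classes. $\mathrm{Mod}(T)$ is the set of models of $T$ with universe $\omega$, a standard Borel space with the usual logic topology. *)

(* Defs.v *)
From mathcomp Require Import all_boot all_order all_algebra.
From mathcomp Require Import all_classical all_reals all_analysis.

Set Implicit Arguments.
Unset Strict Implicit.
Unset Printing Implicit Defensive.

Local Open Scope classical_set_scope.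

Definition borel_set (X : topologicalType) (A : set X) : Prop :=
  <<s @open X >> A.

(* Structures with universe omega for the language {E_n : n in omega} of binary
   relation symbols: the space 2^(omega x omega^2), where the coordinate
   (n, x, y) is the truth value of E_n(x, y).  Its product topology is the
   logic topology. *)
Definition refStructure : topologicalType :=
  prod_topology (fun _ : nat * nat * nat => bool).

Definition interpE (M : refStructure) (n : nat) : rel nat :=
  fun x y => M (n, x, y).

(* In the last clause, y and z represent the two E_(n+1)-classes into which
   the E_n-class of x splits. *)
Definition REFbin (M : refStructure) : Prop :=
  [/\ forall n, equivalence_rel (interpE M n),
      forall x y, interpE M 0 x y,
      forall n x y, interpE M n.+1 x y -> interpE M n x y
    & forall n x, exists y z,
        [/\ interpE M n x y, interpE M n x z, ~~ interpE M n.+1 y z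
          & forall w, interpE M n x w ->
              interpE M n.+1 y w || interpE M n.+1 z w]].

(* As a type, this is [set_type], whose library topology is the subspace one. *)
Definition Mod_REFbin : set refStructure := [set M | REFbin M].

Definition isomorphic (M N : refStructure) : Prop :=
  exists f : nat -> nat, bijective f /\
    forall n x y, interpE M n x y = interpE N n (f x) (f y).

Definition iso_REFbin : set (Mod_REFbin * Mod_REFbin) :=
  [set p | isomorphic (set_val p.1) (set_val p.2)].

(* Main.v *)
(** An element of a model of REF(bin) determines a branch of the binary tree, so
    a model with universe omega amounts to a dense countable set of branches with
    multiplicities in {1, ..., omega}, and isomorphisms are automorphisms of the
    tree that preserve the multiplicities.  For a set T of finite sequences we
    build two models that are isomorphic iff T contains all the finite initial
    segments of some increasing sequence A.

    A branch is read as a finite set b of "bits" and a finite set u of "exits".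
    It is a member of the gadget of u: if u is in T, the multiplicity records the
    parity of the bits from the last exit on; otherwise it only records the bit at
    the last exit.  The two models differ in the value of the missing bit of the
    empty u.  An isomorphism of the models fixes all exits, and must flip the
    bit at the last exit of a branch without other bits, starting with the
    missing bit for u = [].  This is only possible if u is in T and some later
    bit a is flipped, and then the argument repeats with u extended by a.
    Conversely, flipping along A the bits A_0, A_1, ... is an isomorphism: in the
    gadgets met by A two flips cancel, and the others are not affected.

    Hence every analytic set reduces continuously to isomorphism.  The continuous
    preimage of a Borel set is analytic and coanalytic, and the diagonal argument
    gives an analytic set that is not coanalytic. *)

Require Import Defs.
From mathcomp Require Import all_boot all_order all_algebra.
From mathcomp Require Import finmap zify.
From mathcomp Require Import all_classical all_reals all_analysis.

Set Implicit Arguments.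
Unset Strict Implicit.
Unset Printing Implicit Defensive.

Local Open Scope classical_set_scope.

(** * Models given by branches *)

Definition agree (s t : nat -> bool) (n : nat) : Prop := forall i, i < n -> s i = t i.

Definition branch_model (h : nat -> nat -> bool) : refStructure :=
  fun t => all (fun i => h t.1.2 i == h t.2 i) (iota 0 t.1.1).

Lemma branch_modelP h n x y :
  reflect (agree (h x) (h y) n) (interpE (branch_model h) n x y).
Proof.
apply: (iffP allP) => /= hxy i.
  by move=> lt_in; apply/eqP/hxy; rewrite mem_iota.
by rewrite mem_iota => /hxy ->.
Qed.

Lemma REFbin_branch_model h :
  (forall s n, exists x, agree (h x) s n) -> REFbin (branch_model h).
Proof.
move=> dense_h; split=> [n x y z|x y|n x y /branch_modelP hxy|n x].
- split; first exact/branch_modelP.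
  move=> /branch_modelP hxy; apply/idP/idP => /branch_modelP h'.
    by apply/branch_modelP => i lt_in; rewrite -hxy ?h'.
  by apply/branch_modelP => i lt_in; rewrite hxy ?h'.
- exact/branch_modelP.
- by apply/branch_modelP => i lt_in; apply: hxy; apply: ltnW.
have [y hy] := dense_h (fun i => if i < n then h x i else true) n.+1.
have [z hz] := dense_h (fun i => if i < n then h x i else false) n.+1.
exists y, z; split.
- by apply/branch_modelP => i lt_in; rewrite hy ?lt_in // ltnW.
- by apply/branch_modelP => i lt_in; rewrite hz ?lt_in // ltnW.
- by apply/branch_modelP => /(_ n (ltnSn n)); rewrite hy // hz // ltnn.
move=> w /branch_modelP hxw; apply/orP.
case hwn: (h w n); [left|right]; apply/branch_modelP => i; rewrite ltnS => le_in.
  by rewrite hy //; case: ltngtP le_in => // [/hxw|->].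
by rewrite hz //; case: ltngtP le_in => // [/hxw|->].
Qed.

(* (b, u, j) is the j-th candidate for an element with bits b and exits u. *)
Definition cell : Type := ({fset nat} * seq nat * nat)%type.

(** One enumeration of the cells, independent of [T], makes omega the universe of all the coded
    models. *)
Lemma ex_cell_enum : exists e : nat -> cell, bijective e.
Proof.
have inj_f : injective (fun n : nat => (fset0, [::], n) : cell) by move=> x y [].
have : ([set: cell] #= [set: nat])%card.
  apply: eq_card_nat; first exact: countableP.
  apply/infiniteP; rewrite -(card_le_eql (inj_card_eq (in2W inj_f))).
  exact: subset_card_le.
by move=> /card_set_bijP[f]; rewrite setTT_bijective => -[g fK gK]; exists g, f.
Qed.

(* The value eps of the empty u tells the two models of a pair apart. *)
Definition anchor (eps : bool) (u : seq nat) (b : {fset nat}) : bool :=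
  if u is [::] then eps else last 0 u \in b.

(** The bits that enter the parity begin one past the last exit, whose own bit is the anchor, or at
    0 if there is no exit. *)
Definition start (u : seq nat) : nat := last 0 [seq i.+1 | i <- u].

Definition parity_from (m : nat) (b : {fset nat}) : bool :=
  odd #|` [fset i in b | m <= i]%fset|.

Definition colour (T : seq nat -> bool) eps u b : bool :=
  anchor eps u b (+) (T u && parity_from (start u) b).

(* The multiplicity determines u, so isomorphisms preserve exits.  Sequences that
   are not sorted are redundant descriptions of a finite set: they get 0. *)
Definition mult T eps u b : nat :=
  if sorted ltn u then (choice.pickle u).*2 + (colour T eps u b).+1 else 0.

(* Position 0 separates the j < mult from the others, which lie on branches
   of infinite multiplicity; with them the universe does not depend on T. *)
Definition branch T eps (c : cell) (p : nat) : bool :=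
  let: (b, u, j) := c in
  if p is q.+1 then (if odd q then q./2 \in u else q./2 \in b)
  else mult T eps u b <= j.

(** * Multiplicities are invariant under isomorphism *)

Lemma branch_bit T eps b u j i : branch T eps (b, u, j) i.*2.+1 = (i \in b).
Proof. by rewrite /= odd_double half_double. Qed.

Lemma branch_exit T eps b u j i : branch T eps (b, u, j) i.*2.+2 = (i \in u).
Proof. by rewrite /= odd_double /= uphalf_double. Qed.

Lemma sorted_of_mult T eps u b j : j < mult T eps u b -> sorted ltn u.
Proof. by rewrite /mult; case: ifP. Qed.

Lemma mult_gt0 T eps u b : (0 < mult T eps u b) = sorted ltn u.
Proof. by rewrite /mult; case: ifP; rewrite // addnS. Qed.

Lemma mult_inj T eps eps' u u' b b' : sorted ltn u ->
  mult T eps u b = mult T eps' u' b' ->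
  u = u' /\ colour T eps u b = colour T eps' u' b'.
Proof.
rewrite /mult => ->; case: ifP => _; last by rewrite addnS.
rewrite !addnS => -[eq_uc].
have := congr1 odd eq_uc; rewrite !oddD !odd_double !oddb !addFb => eq_c.
split=> //; move: eq_uc; rewrite eq_c => /addIn/double_inj.
exact: (pcan_inj (@choice.pickleK _)).
Qed.

Lemma sorted_ltn_mem_inj (u v : seq nat) :
  sorted ltn u -> sorted ltn v -> u =i v -> u = v.
Proof. exact: (irr_sorted_eq ltn_trans ltnn). Qed.

(** Position 0 puts the other cell below its own multiplicity too, so its exit list is sorted and
    hence determined by its members. *)
Lemma branch_inj T eps b u j b' u' j' : j < mult T eps u b ->
  branch T eps (b, u, j) =1 branch T eps (b', u', j') ->
  [/\ b' = b, u' = u & j' < mult T eps u b].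
Proof.
move=> lt_j eq_br.
have := eq_br 0; rewrite /= leqNgt lt_j /= => /esym/negbT; rewrite -ltnNge => lt_j'.
have eq_b : b' = b by apply/fsetP => i; have := eq_br i.*2.+1; rewrite !branch_bit.
have eq_u : u' = u.
  apply: sorted_ltn_mem_inj (sorted_of_mult lt_j') (sorted_of_mult lt_j) _ => i.
  by have := eq_br i.*2.+2; rewrite !branch_exit.
by rewrite -{2}eq_b -{2}eq_u.
Qed.

Lemma size_branch_class T eps b u j (L : seq cell) : j < mult T eps u b ->
  uniq L -> (forall c, c \in L -> branch T eps (b, u, j) =1 branch T eps c) ->
  size L <= mult T eps u b.
Proof.
move=> lt_j uL classL.
have L_j c : c \in L -> c = (b, u, c.2) /\ c.2 < mult T eps u b.
  by case: c => -[b' u'] j' /classL/(branch_inj lt_j)[-> ->].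
rewrite -(size_map snd) -(size_iota 0 (mult T eps u b)); apply: uniq_leq_size.
  rewrite map_inj_in_uniq // => c d /L_j[-> _] /L_j[-> _] /= -> //.
by move=> _ /mapP[c /L_j[_ lt_c] ->]; rewrite mem_iota.
Qed.

Definition branch_iso T eps eps' (f : cell -> cell) : Prop :=
  forall c d n, agree (branch T eps c) (branch T eps d) n <->
    agree (branch T eps' (f c)) (branch T eps' (f d)) n.

Lemma branch_iso_inv T eps eps' f g : cancel g f ->
  branch_iso T eps eps' f -> branch_iso T eps' eps g.
Proof. by move=> gK iso_f c d n; rewrite (iso_f (g c)) !gK. Qed.

Lemma branch_iso_eq T eps eps' f c d : branch_iso T eps eps' f ->
  branch T eps c =1 branch T eps d -> branch T eps' (f c) =1 branch T eps' (f d).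
Proof.
move=> iso_f eq_cd i; have [+ _] := iso_f c d i.+1.
by apply=> // k _; apply: eq_cd.
Qed.

(** A cell at or above its multiplicity shares its branch with infinitely many others; pulled back
    by [g], these would overfill the class of [(b, u, j)]. *)
Lemma branch_iso_good T eps eps' f g b u j b' u' j' :
  cancel f g -> cancel g f -> branch_iso T eps eps' f ->
  j < mult T eps u b -> f (b, u, j) = (b', u', j') -> j' < mult T eps' u' b'.
Proof.
move=> fK gK iso_f lt_j fc; rewrite ltnNge; apply/negP => le_j'.
pose L := [seq g (b', u', j' + i) | i <- iota 0 (mult T eps u b).+1].
suff : size L <= mult T eps u b by rewrite size_map size_iota ltnn.
apply: (size_branch_class lt_j).
  by rewrite map_inj_uniq ?iota_uniq // => x y /(can_inj gK)[/addnI].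
move=> _ /mapP[i _ ->]; rewrite -(fK (b, u, j)) fc.
apply: branch_iso_eq (branch_iso_inv gK iso_f) _ => -[|p] //=.
by rewrite le_j' (leq_trans le_j') // leq_addr.
Qed.

Lemma branch_iso_mult_le T eps eps' f g b u j b' u' j' :
  cancel f g -> cancel g f -> branch_iso T eps eps' f ->
  j < mult T eps u b -> f (b, u, j) = (b', u', j') ->
  mult T eps u b <= mult T eps' u' b'.
Proof.
move=> fK gK iso_f lt_j fc.
have lt_j' := branch_iso_good fK gK iso_f lt_j fc.
pose L := [seq f (b, u, i) | i <- iota 0 (mult T eps u b)].
have -> : mult T eps u b = size L by rewrite size_map size_iota.
apply: (size_branch_class lt_j').
  by rewrite map_inj_uniq ?iota_uniq // => x y /(can_inj fK)[].
move=> _ /mapP[i + ->]; rewrite mem_iota -fc => /= lt_i.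
apply: branch_iso_eq iso_f _ => -[|p] //=.
by rewrite leqNgt lt_j leqNgt lt_i.
Qed.

Lemma branch_iso_mult T eps eps' f g b u j b' u' j' :
  cancel f g -> cancel g f -> branch_iso T eps eps' f ->
  j < mult T eps u b -> f (b, u, j) = (b', u', j') ->
  mult T eps u b = mult T eps' u' b'.
Proof.
move=> fK gK iso_f lt_j fc; apply/eqP; rewrite eqn_leq.
rewrite (branch_iso_mult_le fK gK iso_f lt_j fc) /=.
apply: (branch_iso_mult_le gK fK (branch_iso_inv gK iso_f) _ (esym _)).
  exact: branch_iso_good lt_j fc.
by rewrite -fc fK.
Qed.

Lemma start_rcons u a : start (rcons u a) = a.+1.
Proof. by rewrite /start map_rcons last_rcons. Qed.

Lemma anchor_rcons eps u a b : anchor eps (rcons u a) b = (a \in b).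
Proof. by rewrite /anchor; case: u => //= x u; rewrite last_rcons. Qed.

Lemma sorted_rcons_ltn u a : sorted ltn u -> start u <= a -> sorted ltn (rcons u a).
Proof.
elim/last_ind: u => [//|u x _]; rewrite start_rcons => su lt_xa.
by case: u su => [|y u] /=; rewrite ?lt_xa ?andbT // !rcons_path last_rcons => ->.
Qed.

(** * From an isomorphism to a path *)

Lemma in_from m (b : {fset nat}) i :
  (i \in [fset i in b | m <= i]%fset) = (i \in b) && (m <= i).
Proof. by rewrite !inE. Qed.

Lemma parity_fromP m b : parity_from m b -> exists2 i, i \in b & m <= i.
Proof.
move=> odd_b; have /fset0Pn[i] : [fset i in b | m <= i]%fset != fset0.
  by rewrite -cardfs_gt0; move: odd_b; rewrite /parity_from; case: #|` _|.
by rewrite !inE => /andP[]; exists i.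
Qed.

Lemma parity_from0 m : parity_from m fset0 = false.
Proof. by apply/negbTE/negP => /parity_fromP[i]; rewrite inE. Qed.

Lemma path_of_branch_iso T f g : cancel f g -> cancel g f ->
  branch_iso T false true f -> exists A : nat -> nat, forall n, T (mkseq A n).
Proof.
move=> fK gK iso_f.
pose z u : cell := (fset0, u, 0).
(* In the source model every [z u] has anchor 0, so anchor 1 in the image is a change. *)
pose flipped u := sorted ltn u && anchor true u (f (z u)).1.1.
have z_good u : sorted ltn u -> 0 < mult T false u fset0 by rewrite mult_gt0.
have step u : flipped u -> T u /\ exists a, flipped (rcons u a).
  rewrite /flipped; case fz: (f (z u)) => [[b' u'] j'] /= /andP[su anchor_b'].
  have lt_j' := branch_iso_good fK gK iso_f (z_good _ su) fz.
  have [eq_u] := mult_inj su (branch_iso_mult fK gK iso_f (z_good _ su) fz).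
  rewrite -eq_u /colour anchor_b' parity_from0 andbF addbF.
  have -> : anchor false u fset0 = false by case: (u).
  (* The colour 0 of [z u] is preserved despite the anchor 1, so the parity term must be 1; [a] is
     one of the oddly many bits it counts. *)
  rewrite addTb => /esym/negbFE/andP[Tu /parity_fromP[a b'a le_a]]; split=> //.
  have sua := sorted_rcons_ltn su le_a; exists a; rewrite sua anchor_rcons /=.
  (* The two branches first differ at exit [a], right after bit [a], so their images share bit
     [a]. *)
  have agree_z : agree (branch T false (z u)) (branch T false (z (rcons u a))) a.*2.+2.
    move=> [_|p lt_p] /=; first by rewrite leqNgt z_good // leqNgt z_good.
    case: ifP => // odd_p; rewrite mem_rcons inE; case: eqVneq => // eq_p.
    by move: (odd_double_half p); rewrite eq_p odd_p; lia.
  have [+ _] := iso_f (z u) (z (rcons u a)) a.*2.+2.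
  move=> /(_ agree_z a.*2.+1 (ltnSn _)); rewrite fz branch_bit b'a.
  by case: (f _) => -[b2 u2] j2; rewrite branch_bit => <-.
have /choice[next nextP] u : exists a, flipped u -> T u /\ flipped (rcons u a).
  case: (boolP (flipped u)) => [/step[Tu [a fa]]|_]; first by exists a.
  by exists 0.
pose U := fix U n := if n is m.+1 then rcons (U m) (next (U m)) else [::].
exists (fun n => next (U n)) => n.
have -> : mkseq (fun n => next (U n)) n = U n.
  by elim: n => // n IHn; rewrite mkseqS IHn.
(* The induction starts because the empty sequence has anchor 1 in the second model by
   definition. *)
suff /nextP[] : flipped (U n) by [].
by elim: n => [|n /nextP[]].
Qed.

(** * From a path to an isomorphism *)

Definition symdiff (b c : {fset nat}) : {fset nat} := ((b `\` c) `|` (c `\` b))%fset.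

Lemma in_symdiff b c i : (i \in symdiff b c) = (i \in b) (+) (i \in c).
Proof. by rewrite !inE; case: (i \in b); case: (i \in c). Qed.

Lemma symdiffK c : involutive (symdiff^~ c).
Proof. by move=> b; apply/fsetP => i; rewrite !in_symdiff -addbA addbb addbF. Qed.

Lemma odd_symdiff b c : odd #|` symdiff b c| = odd #|` b| (+) odd #|` c|.
Proof.
rewrite -(cardfsID c b) -(cardfsID b c) fsetIC !oddD.
rewrite cardfsU !oddB; last first.
  by rewrite -cardfsUI leq_addl.
rewrite (_ : _ `&` _ = fset0)%fset ?cardfs0 ?oddD ?addbF.
  by case: (odd _); case: (odd _); case: (odd _).
by apply/fsetP => i; rewrite !inE; case: (i \in b); case: (i \in c).
Qed.

Lemma parity_from_symdiff m b c :
  parity_from m (symdiff b c) = parity_from m b (+) parity_from m c.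
Proof.
rewrite -odd_symdiff; congr (odd #|` _|); apply/fsetP => i.
rewrite in_symdiff !inE; case: (m <= i); rewrite ?andbF // !andbT.
by case: (i \in b); case: (i \in c).
Qed.

Lemma mem_lt_start u x : sorted ltn u -> x \in u -> x < start u.
Proof.
elim/last_ind: u => [//|u y IHu].
rewrite start_rcons mem_rcons inE => su /predU1P[->//|ux].
suff: x < y by lia.
move: su; rewrite -cats1 (sorted_pairwise ltn_trans) pairwise_cat allrel1r.
by case/and3P => /allP/(_ x ux).
Qed.

(* The elements of A below which u agrees with A; as k <= size u for these A k,
   the set is finite. *)
Definition flips (A : nat -> nat) (u : seq nat) : {fset nat} :=
  [fset i in [seq A k | k <- iota 0 (size u).+1
     & all (fun x => (x \in u) == (x \in mkseq A k)) (iota 0 (A k))]]%fset.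

Lemma mkseq_sorted A n : {homo A : i j / i < j} -> sorted ltn (mkseq A n).
Proof. by move=> incA; apply: homo_sorted incA _ (iota_ltn_sorted 0 n). Qed.

Lemma mem_mkseq_lt A k n : {homo A : i j / i < j} ->
  (A k \in mkseq A n) = (k < n).
Proof.
move=> incA; apply/mapP/idP => [[i]|lt_kn]; last by exists k; rewrite ?mem_iota.
rewrite mem_iota /= => lt_in eqA; suff -> : k = i by [].
by case: (ltngtP k i) => // /incA; rewrite eqA ltnn.
Qed.

Lemma flipsP A u i : {homo A : i j / i < j} ->
  reflect (exists2 k, i = A k & forall x, x < A k -> (x \in u) = (x \in mkseq A k))
    (i \in flips A u).
Proof.
move=> incA; rewrite inE; apply: (iffP mapP) => -[k].
  rewrite mem_filter => /andP[/allP ukA _] ->; exists k => // x lt_x.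
  by apply/eqP/ukA; rewrite mem_iota.
move=> -> ukA; exists k => //; rewrite mem_filter mem_iota add0n ltnS /=.
apply/andP; split.
  by apply/allP => x; rewrite mem_iota => /= /ukA ->.
(* The bound [k <= size u] holds since the [k] distinct values of [A] below [A k] all lie in [u]. *)
rewrite -(size_mkseq A k); apply: uniq_leq_size.
  exact: sorted_uniq ltn_trans ltnn _ (mkseq_sorted k incA).
move=> _ /mapP[j + ->]; rewrite mem_iota => /= lt_jk.
by rewrite ukA ?incA // mem_mkseq_lt.
Qed.

(** Only exits below [i] decide whether bit [i] is flipped. They precede bit [i] on a branch, so
    flipping respects agreement up to any level. *)
Lemma flips_agree A u v i : {homo A : i j / i < j} ->
  (forall x, x < i -> (x \in u) = (x \in v)) -> (i \in flips A u) = (i \in flips A v).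
Proof.
move=> incA eq_uv; apply/flipsP/flipsP => // -[k eq_i ukA]; exists k => // x lt_x.
  by rewrite -eq_uv ?eq_i ?ukA.
by rewrite eq_uv ?eq_i ?ukA.
Qed.

(** On the path the flips are [A 0], ..., [A n], and [start] is past all of these but the last. *)
Lemma flips_path A n i : {homo A : i j / i < j} ->
  start (mkseq A n) <= i -> (i \in flips A (mkseq A n)) = (i == A n).
Proof.
move=> incA le_i; apply/(flipsP _ _ incA)/eqP => [[k eq_i ukA]|->]; last by exists n.
rewrite eq_i; congr (A _); case: (ltngtP k n) => // [lt_kn|lt_nk].
  have /mem_lt_start : A k \in mkseq A n by rewrite mem_mkseq_lt.
  by move=> /(_ (mkseq_sorted n incA)); move: le_i; rewrite eq_i; lia.
by have := ukA _ (incA _ _ lt_nk); rewrite !mem_mkseq_lt // lt_nk ltnn.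
Qed.

(** Here [i] is some [A k], and [u] agrees with [A] below it and has nothing beyond it, so only the
    membership of [A k] in [u] is open. Off the path, therefore, no flip reaches a bit that the
    colour uses. *)
Lemma flips_off_path A u i : {homo A : i j / i < j} -> sorted ltn u ->
  i \in flips A u -> start u <= i.+1 -> exists n, u = mkseq A n.
Proof.
move=> incA su /(flipsP _ _ incA)[k -> ukA] le_i.
have lt_u x : x \in u -> x <= A k by move=> /(mem_lt_start su); lia.
have lt_path x : x \in mkseq A k -> x < A k.
  by move=> /mapP[j + ->]; rewrite mem_iota => /= /incA.
have off x : A k < x -> (x \in u) = (x \in mkseq A k).
  move=> lt_x; apply/idP/idP => [/lt_u|/lt_path]; first by rewrite leqNgt lt_x.
  by rewrite ltnNge ltnW.
case: (boolP (A k \in u)) => Ak_u; [exists k.+1|exists k];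
  apply: sorted_ltn_mem_inj (mkseq_sorted _ incA) _ => // x.
  by rewrite mkseqS mem_rcons inE; case: (ltngtP x (A k)) => [/ukA|/off|->].
by case: (ltngtP x (A k)) => [/ukA|/off|->] //; rewrite (negbTE Ak_u) mem_mkseq_lt ?ltnn.
Qed.

Definition flip (A : nat -> nat) (c : cell) : cell :=
  let: (b, u, j) := c in (symdiff b (flips A u), u, j).

Lemma flipK A : involutive (flip A).
Proof. by move=> [[b u] j] /=; rewrite symdiffK. Qed.

Lemma colour_flip (T : seq nat -> bool) A u b : {homo A : i j / i < j} ->
  (forall n, T (mkseq A n)) -> sorted ltn u ->
  colour T true u (symdiff b (flips A u)) = colour T false u b.
Proof.
move=> incA TA su; rewrite /colour parity_from_symdiff.
have [[n eq_u]|off_path] := pselect (exists n, u = mkseq A n).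
  have -> : parity_from (start u) (flips A u).
    rewrite /parity_from (_ : [fset _ in _ | _]%fset = [fset A n]%fset) ?cardfs1 //.
    apply/fsetP => i; rewrite in_from in_fset1 andbC eq_u; case: leqP => [le_i|lt_i] /=.
      exact: flips_path.
    apply/esym/eqP => eq_i; move: lt_i; rewrite eq_i ltnNge => /negP; apply.
    case: (n) => // m; rewrite mkseqS start_rcons; exact: incA.
  suff -> : anchor true u (symdiff b (flips A u)) = ~~ anchor false u b.
    have Tu : T u by rewrite eq_u.
    by rewrite Tu !andTb addbT addNb addbN negbK.
  (* For the empty [u] the anchor changes through [eps]; otherwise the bit at the last exit [A n] is
     itself flipped. *)
  case: n eq_u => [->//|n]; rewrite mkseqS => ->.
  rewrite !anchor_rcons in_symdiff -addbT; congr (_ (+) _).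
  apply/flipsP => //; exists n => // x lt_x.
  by rewrite mem_rcons inE ltn_eqF.
have noflip i : start u <= i.+1 -> (i \in flips A u) = false.
  by move=> le_i; apply: contra_notF off_path => /flips_off_path; apply.
have -> : parity_from (start u) (flips A u) = false.
  by apply/negbTE/negP => /parity_fromP[i fi /leqW/noflip]; rewrite fi.
rewrite addbF; congr (_ (+) _); case/lastP: u {su} noflip off_path => [_|u a noflip _].
  by case; exists 0.
by rewrite !anchor_rcons in_symdiff noflip ?addbF // start_rcons.
Qed.

Lemma branch_iso_flip (T : seq nat -> bool) A : {homo A : i j / i < j} ->
  (forall n, T (mkseq A n)) -> branch_iso T false true (flip A).
Proof.
move=> incA TA.
have mult_flip b u : mult T true u (symdiff b (flips A u)) = mult T false u b.
  by rewrite /mult; case: ifP => // su; rewrite colour_flip.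
have flip_bit eps b u j i : branch T eps (flip A (b, u, j)) i.*2.+1 =
    (i \in b) (+) (i \in flips A u).
  by rewrite branch_bit in_symdiff.
have eq_flips u v n i : i.*2.+1 < n ->
    (forall x, x.*2.+2 < n -> (x \in u) = (x \in v)) ->
    (i \in flips A u) = (i \in flips A v).
  by move=> lt_i eq_uv; apply: flips_agree => // x lt_x; apply: eq_uv; lia.
have parity_ind (P : nat -> Prop) :
    P 0 -> (forall i, P i.*2.+1) -> (forall i, P i.*2.+2) -> forall p, P p.
  move=> P0 Pb Pe [//|p]; rewrite -(odd_double_half p).
  by case: (odd p); [apply: Pe|apply: Pb].
move=> [[b u] j] [[b' u'] j'] n; split=> eq_br.
  elim/parity_ind => [/eq_br|i|i].
  - by rewrite /= !mult_flip.
  - move=> lt_i; rewrite !flip_bit; congr (_ (+) _).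
      by have := eq_br _ lt_i; rewrite !branch_bit.
    by apply: eq_flips lt_i _ => x /eq_br; rewrite !branch_exit.
  - by move=> /eq_br; rewrite !branch_exit.
elim/parity_ind => [/eq_br|i|i].
- by rewrite /= !mult_flip.
- move=> lt_i; have := eq_br _ lt_i; rewrite !flip_bit !branch_bit.
  rewrite (eq_flips u u' n i lt_i) => [/addIb//|x /eq_br].
  by rewrite !branch_exit.
- by move=> /eq_br; rewrite !branch_exit.
Qed.

(** * Density, and the coded models on omega *)

Lemma branch_dense T eps s n : exists c, agree (branch T eps c) s n.
Proof.
pose b := [fset i in iota 0 n | s i.*2.+1]%fset.
pose u := [seq i <- iota 0 n | s i.*2.+2].
have su : sorted ltn u by apply: sorted_filter ltn_trans _ _ (iota_ltn_sorted 0 n).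
(* The index [j] sets position 0: the multiplicity is positive, so 0 lies below it and the
   multiplicity itself does not. *)
exists (b, u, if s 0 then mult T eps u b else 0) => -[_|p lt_p] /=.
  by case: (s 0); rewrite ?leqnn // leqNgt mult_gt0 su.
have lt_h : p./2 < n by lia.
case: ifP => odd_p; rewrite ?inE ?mem_filter /= mem_iota lt_h ?andbT /=;
  by congr (s _); move: (odd_double_half p); rewrite odd_p; lia.
Qed.

Definition path_model (e : nat -> cell) T eps : refStructure :=
  branch_model (fun x => branch T eps (e x)).

Lemma REFbin_path_model e T eps : bijective e -> REFbin (path_model e T eps).
Proof.
move=> [d eK dK]; apply: REFbin_branch_model => s n.
by have [c cs] := branch_dense T eps s n; exists (d c); rewrite dK.
Qed.

Lemma path_modelP e T eps n x y :
  reflect (agree (branch T eps (e x)) (branch T eps (e y)) n)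
    (interpE (path_model e T eps) n x y).
Proof. exact: branch_modelP. Qed.

Lemma path_of_isomorphic e T : bijective e ->
  isomorphic (path_model e T false) (path_model e T true) ->
  exists A : nat -> nat, forall n, T (mkseq A n).
Proof.
move=> [d eK dK] [f [[g fK gK] iso_f]].
apply: (@path_of_branch_iso T (e \o f \o d) (e \o g \o d)) => [c|c|c c' n] /=.
- by rewrite eK fK dK.
- by rewrite eK gK dK.
rewrite -{1}(dK c) -{1}(dK c'); split=> /path_modelP.
  by rewrite iso_f => /path_modelP.
by rewrite -iso_f => /path_modelP.
Qed.

Lemma isomorphic_of_path e (T : seq nat -> bool) A : bijective e ->
  {homo A : i j / i < j} -> (forall n, T (mkseq A n)) ->
  isomorphic (path_model e T false) (path_model e T true).
Proof.
move=> [d eK dK] incA TA; have iso_flip := branch_iso_flip incA TA.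
exists (d \o flip A \o e); split.
  by exists (d \o flip A \o e) => x /=; rewrite dK flipK eK.
move=> n x y; apply/path_modelP/path_modelP; rewrite /= !dK => ?; exact/iso_flip.
Qed.

(** * Analytic sets *)

Definition prefix_pair : Type := (seq bool * seq nat)%type.

Definition initial_seg (y : prefix_pair -> bool) (n : nat) : seq bool :=
  mkseq (fun i => oapp y false (choice.unpickle i)) n.

Arguments initial_seg : simpl never.

Lemma size_initial_seg y n : size (initial_seg y n) = n.
Proof. exact: size_mkseq. Qed.

Lemma take_initial_seg y m n : m <= n -> take m (initial_seg y n) = initial_seg y m.
Proof. by move=> le_mn; rewrite -map_take take_iota (minn_idPl le_mn). Qed.

Lemma initial_seg_eq y y' (w : prefix_pair) n :
  choice.pickle w < n -> initial_seg y n = initial_seg y' n -> y w = y' w.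
Proof.
move=> lt_w /(congr1 (fun s => nth false s (choice.pickle w))).
by rewrite !nth_mkseq // choice.pickleK.
Qed.

(** These are the projections of closed subsets of Cantor space times Baire space. *)
Definition analytic (P : (prefix_pair -> bool) -> Prop) : Prop :=
  exists S : seq bool -> seq nat -> Prop,
    forall y, P y <-> exists a, forall n, S (initial_seg y n) (mkseq a n).

(** The point [y] also serves as the code of the relation [S], which makes the set diagonal. *)
Definition universal_analytic (y : prefix_pair -> bool) : Prop :=
  exists a, forall n, y (initial_seg y n, mkseq a n).

Lemma not_analytic_universal : ~ analytic (fun y => ~ universal_analytic y).
Proof.
move=> [S SP]; pose y (w : prefix_pair) := `[< S w.1 w.2 >].
have : ~ universal_analytic y <-> universal_analytic y.
  rewrite SP; split=> -[a Sa]; exists a => n; first exact/asboolP/Sa.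
  exact/asboolP/(Sa n).
by tauto.
Qed.

Lemma analytic_ext P Q : (forall y, P y <-> Q y) -> analytic P -> analytic Q.
Proof. by move=> PQ [S SP]; exists S => y; rewrite -PQ. Qed.

Definition prefix_open (P : (prefix_pair -> bool) -> Prop) : Prop :=
  forall y, P y -> exists n, forall y', initial_seg y' n = initial_seg y n -> P y'.

(** The witness [a 0] guesses the length [k] of a segment that forces [P]. The test waits for length
    [k.+1], where [a 0] is visible even if [k] is 0. *)
Lemma analytic_open P : prefix_open P -> analytic P.
Proof.
move=> openP.
exists (fun p s => if s is k :: _ then
  size p = k.+1 -> forall y', initial_seg y' k = take k p -> P y' else True).
move=> y; split=> [Py|[a Sa]].
  have [k kP] := openP y Py; exists (fun=> k) => -[//|m] /=.
  by rewrite size_map size_iota => -[->] y'; rewrite take_initial_seg //; apply: kP.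
by apply: (Sa (a 0).+1); rewrite ?size_initial_seg //= take_initial_seg.
Qed.

Lemma analytic_closed P : prefix_open P -> analytic (fun y => ~ P y).
Proof.
move=> openP.
exists (fun p _ => ~ forall y', initial_seg y' (size p) = p -> P y').
move=> y; split=> [nPy|[a Sa] /openP[n nP]].
  by exists id => n; rewrite size_initial_seg => /(_ y erefl).
by apply: (Sa n); rewrite size_initial_seg.
Qed.

Lemma mkseqSr (X : Type) (f : nat -> X) n :
  mkseq f n.+1 = f 0 :: mkseq (fun i => f i.+1) n.
Proof. by rewrite /mkseq /= (iotaDl 1 0) -map_comp. Qed.

(** The first entry of the witness chooses [k], and the rest is a witness for [P k], tested one
    stage late. *)
Lemma analytic_exists (P : nat -> (prefix_pair -> bool) -> Prop) :
  (forall k, analytic (P k)) -> analytic (fun y => exists k, P k y).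
Proof.
move=> /choice[S SP].
exists (fun p s => 0 < size s -> S (head 0 s) (take (size s).-1 p) (behead s)).
move=> y; split=> [[k /SP[a Sa]]|[a Sa]].
  exists (fun n => if n is m.+1 then a m else k) => -[//|n] _.
  by rewrite mkseqSr /= size_mkseq take_initial_seg //; apply: Sa.
exists (a 0); apply/SP; exists (fun i => a i.+1) => n.
have := Sa n.+1; rewrite mkseqSr /= size_mkseq take_initial_seg //; exact.
Qed.

(** One sequence interleaves witnesses for all [k], and a prefix is tested on every part of them
    that it contains. *)
Lemma analytic_forall (P : nat -> (prefix_pair -> bool) -> Prop) :
  (forall k, analytic (P k)) -> analytic (fun y => forall k, P k y).
Proof.
move=> /choice[S SP].
exists (fun p s => forall k n, n <= size p ->
  (forall i, i < n -> choice.pickle (k, i) < size s) ->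
  S k (take n p) (mkseq (fun i => nth 0 s (choice.pickle (k, i))) n)).
move=> y; split=> [Py|[a Sa] k].
  have /choice[a aP] k : exists a, forall n, S k (initial_seg y n) (mkseq a n).
    exact/SP.
  pose a' p := let: (k, i) := odflt (0, 0) (choice.unpickle p) in a k i.
  exists a' => m k n; rewrite size_initial_seg size_mkseq => le_nm lt_m.
  rewrite take_initial_seg //.
  suff -> : mkseq (fun i => nth 0 (mkseq a' m) (choice.pickle (k, i))) n
      = mkseq (a k) n by [].
  apply/eq_in_map => i; rewrite mem_iota => /= lt_in.
  by rewrite nth_mkseq ?lt_m // /a' choice.pickleK.
apply/SP; exists (fun i => a (choice.pickle (k, i))) => n.
(* A prefix of length [m] contains the first [n] entries of the [k]-th witness. *)
pose m := n + \max_(i < n) (choice.pickle (k, i : nat)).+1.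
have lt_m i : i < n -> choice.pickle (k, i) < m.
  move=> lt_in; rewrite -(addn0 (_ (k, i)).+1) addnC leq_add //.
  exact: (leq_bigmax (Ordinal lt_in)).
have := Sa m k n; rewrite size_initial_seg size_mkseq leq_addr => /(_ isT lt_m).
rewrite take_initial_seg ?leq_addr //; congr (S k _ _).
by apply/eq_in_map => i; rewrite mem_iota => /= lt_in; rewrite nth_mkseq ?lt_m.
Qed.

(** * The reduction *)

Definition decode (i : nat) : nat := (odflt (0, 0) (choice.unpickle i)).1.

Lemma decode_infinitely_often v m : exists2 i, m < i & decode i = v.
Proof.
have inj_v : injective (fun k : nat => choice.pickle (v, k)).
  by move=> k l /(pcan_inj (@choice.pickleK _))[].
have [k lt_m] := injective_gtn inj_v m.
by exists (choice.pickle (v, k)); rewrite // /decode choice.pickleK.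
Qed.

Definition prefix_tree (y : prefix_pair -> bool) (u : seq nat) : bool :=
  y (initial_seg y (size u), map decode u).

(* As decode takes each value infinitely often, an arbitrary sequence is the
   image of an increasing one. *)
Lemma isomorphic_prefix_tree e y : bijective e ->
  isomorphic (path_model e (prefix_tree y) false) (path_model e (prefix_tree y) true) <->
  universal_analytic y.
Proof.
move=> be; split=> [/(path_of_isomorphic be)[A TA]|[a ya]].
  exists (decode \o A) => n; have := TA n.
  by rewrite /prefix_tree size_mkseq -map_comp.
have /choice[next nextP] (vm : nat * nat) :
    exists i, vm.2 < i /\ decode i = vm.1.
  by have [i] := decode_infinitely_often vm.1 vm.2; exists i.
pose A := fix A n := next (a n, if n is m.+1 then A m else 0).
have decodeA n : decode (A n) = a n by case: n => [|n]; exact: (nextP (_, _)).2.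
apply: (@isomorphic_of_path _ _ A) => // [|n].
  apply: homo_ltn => [|n]; first exact: ltn_trans.
  by case: (nextP (a n.+1, A n)).
rewrite /prefix_tree size_mkseq -map_comp (eq_map (g := a)) //; exact: ya.
Qed.

(** * Continuity of the reduction *)

Lemma prefix_tree_near (y : prefix_pair -> bool) (ys : nat -> prefix_pair -> bool) u :
  (forall n, initial_seg (ys n) n = initial_seg y n) ->
  \forall n \near \oo, prefix_tree (ys n) u = prefix_tree y u.
Proof.
move=> ysP; exists (maxn (size u)
  (choice.pickle (initial_seg y (size u), map decode u)).+1) => // n /=.
rewrite geq_max => /andP[le_un lt_n]; rewrite /prefix_tree.
rewrite -(take_initial_seg _ le_un) ysP take_initial_seg //.
exact: initial_seg_eq lt_n (ysP n).
Qed.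

(** A single truth value of the model consults [T] only at the exit lists of two cells. *)
Lemma path_model_near e eps (y : prefix_pair -> bool) (ys : nat -> prefix_pair -> bool) t :
  (forall n, initial_seg (ys n) n = initial_seg y n) ->
  \forall n \near \oo,
    path_model e (prefix_tree (ys n)) eps t = path_model e (prefix_tree y) eps t.
Proof.
move=> ysP; case: t => [[k x1] x2].
have := prefix_tree_near (e x2).1.2 ysP; apply: filter_app.
have := prefix_tree_near (e x1).1.2 ysP; apply: filter_app.
near=> n => T1 T2; rewrite /path_model /branch_model /=.
apply: eq_all => -[|p]; rewrite /branch.
  case: (e x1) (e x2) T1 T2 => [[b1 u1] j1] [[b2 u2] j2] /= T1 T2.
  by rewrite /mult /colour T1 T2.
by case: (e x1) (e x2) {T1 T2} => [[b1 u1] j1] [[b2 u2] j2].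
Unshelve. all: by end_near.
Qed.

Definition coded_model e (be : bijective e) eps (y : prefix_pair -> bool) : Mod_REFbin :=
  SigSub (mem_set (REFbin_path_model (prefix_tree y) eps be)).

Lemma cvg_coded_model e (be : bijective e) eps y (ys : nat -> prefix_pair -> bool) :
  (forall n, initial_seg (ys n) n = initial_seg y n) ->
  coded_model be eps (ys n) @[n --> \oo] --> coded_model be eps y.
Proof.
move=> ysP.
have cvgM : path_model e (prefix_tree (ys n)) eps @[n --> \oo] -->
    (path_model e (prefix_tree y) eps : refStructure).
  apply/cvg_sup => t U [_ [[B oB <-] Bt] sBU].
  have := path_model_near e eps t ysP; rewrite nbhs_simpl /=; apply: filter_app.
  by near=> n => eq_t; apply: sBU; rewrite /= eq_t.
move=> U [_ [[B oB <-] By] sBU].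
have /cvgM : nbhs (path_model e (prefix_tree y) eps : refStructure) B.
  exact: open_nbhs_nbhs.
by apply: (@filterS _ \oo) => n Bn; exact: sBU.
Unshelve. all: by end_near.
Qed.

Definition coded_pair e (be : bijective e) y : Mod_REFbin * Mod_REFbin :=
  (coded_model be false y, coded_model be true y).

(** Otherwise some points [ys n], equal to [y] on the first [n] bits, have coded pairs outside [O]
    that converge to a point of [O]. *)
Lemma prefix_open_coded_pair e (be : bijective e) (O : set (Mod_REFbin * Mod_REFbin)) :
  open O -> prefix_open (fun y => O (coded_pair be y)).
Proof.
move=> oO y Oy; apply: contrapT => noprefix.
have /choice[ys ysP] n :
    exists y', initial_seg y' n = initial_seg y n /\ ~ O (coded_pair be y').
  apply: contrapT => noy; apply: noprefix; exists n => y' eq_y'.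
  by apply: contrapT => nOy'; apply: noy; exists y'.
have cvgM eps := @cvg_coded_model e be eps y ys (fun n => (ysP n).1).
have cvgP : coded_pair be (ys n) @[n --> \oo] --> coded_pair be y.
  exact: cvg_pair (cvgM false) (cvgM true).
have /cvgP[N _ /(_ N (leqnn N))] := open_nbhs_nbhs (conj oO Oy).
exact: (ysP N).2.
Qed.

(** The sets with analytic and coanalytic preimage form a sigma-algebra containing the open sets;
    complements swap the two halves. *)
Lemma borel_analytic e (be : bijective e) (B : set (Mod_REFbin * Mod_REFbin)) :
  borel_set B -> analytic (fun y => B (coded_pair be y)) /\
    analytic (fun y => ~ B (coded_pair be y)).
Proof.
pose bianalytic := [set A : set (Mod_REFbin * Mod_REFbin) |
  analytic (fun y => A (coded_pair be y)) /\
  analytic (fun y => ~ A (coded_pair be y))].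
move=> borelB; apply: (smallest_sub (X := bianalytic)) borelB; last first.
  move=> O /(@prefix_open_coded_pair e be) oO.
  by split; [apply: analytic_open|apply: analytic_closed].
split=> [|A [anA anCA]|A anA].
- split; first by apply: analytic_open => y.
  by apply: analytic_closed => y.
- rewrite setTD; split=> //; apply: analytic_ext anA => y.
  by split=> [Ay /(_ Ay)|/contrapT].
split.
  apply: analytic_ext (analytic_exists (fun k => (anA k).1)) => y.
  by split=> [[k Ak]|[k _ Ak]]; exists k.
apply: analytic_ext (analytic_forall (fun k => (anA k).2)) => y.
by split=> [nA [k _]|nA k Ak]; [apply: nA|apply: nA; exists k].
Qed.

Theorem theorem5p6 : ~ borel_set iso_REFbin.
Proof.
have [e be] := ex_cell_enum.
move=> /(borel_analytic be)[_ an]; apply: not_analytic_universal.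
apply: analytic_ext an => y; rewrite /iso_REFbin /=.
by rewrite -(isomorphic_prefix_tree y be).
Qed.
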